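(* Let $G$ be a graph with convex balls. Then $h(G)=h_2(G)$.
   Context: Graphs are simple, undirected, connected, with all cliques finite; $d$ is the graph distance; a vertex set $C$ is convex if it contains every vertex on a shortest path between two vertices of $C$; $G$ has convex balls if all balls $B_r(v)$ are convex. $\mathrm{conv}(S)$ is the smallest convex set containing $S$. A finite vertex set $A$ is Helly independent ($h$-independent) if $\bigcap_{a\in A}\mathrm{conv}(A\setminus\{a\})=\emptyset$. The Helly number $h(G)$ is the supremum of the sizes of $h$-independent sets of $G$, and $h_2(G)$ is the supremum of the sizes of $h$-independent sets of diameter at most $2$ (diameter $\max\{d(x,y):x,y\in A\}$). *)

(* Defs.v *)
From HB Require Import structures.
From mathcomp Require Import all_boot all_order all_algebra finmap.
From mathcomp Require Import all_classical all_reals ereal.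

Set Implicit Arguments.
Unset Strict Implicit.
Unset Printing Implicit Defensive.

Local Open Scope classical_set_scope.

Definition clique (V : choiceType) (e : rel V) (K : set V) : Prop :=
  forall x y, K x -> K y -> x != y -> e x y.

(* Possibly infinite; cliques are finite, but of possibly unbounded size. *)
Record graph := Graph {
  vertex :> choiceType;
  adj : rel vertex;
  adj_sym : symmetric adj;
  adj_irr : irreflexive adj;
  adj_connected : forall x y, exists2 p, path adj x p & last x p = y;
  adj_clique_finite : forall K, clique adj K -> finite_set K }.

(* [x :: p] is the vertex sequence of a walk of length [size p] from x to y. *)
Definition walk (G : graph) (x y : G) (p : seq G) : Prop :=
  path (@adj G) x p /\ last x p = y.

Lemma ex_walk_length (G : graph) (x y : G) :
  exists n, `[< exists2 p, walk x y p & size p = n >].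
Proof.
have [p px py] := adj_connected x y.
by exists (size p); apply/asboolP; exists p.
Qed.

Definition dist (G : graph) (x y : G) : nat := ex_minn (ex_walk_length x y).

Definition shortest_path (G : graph) (x y : G) (p : seq G) : Prop :=
  walk x y p /\ size p = dist x y.

Definition convex (G : graph) (C : set G) : Prop :=
  forall x y p, C x -> C y -> shortest_path x y p ->
  forall z, z \in x :: p -> C z.

Definition ball (G : graph) (r : nat) (v : G) : set G :=
  [set w | (dist v w <= r)%N].

Definition has_convex_balls (G : graph) : Prop :=
  forall (v : G) (r : nat), convex (ball r v).

Definition conv (G : graph) (S : set G) : set G := smallest (@convex G) S.

Definition h_independent (G : graph) (A : {fset G}) : Prop :=
  \bigcap_(a in [set` A]) conv [set` (A `\ a)%fset] = set0.

Definition diam (G : graph) (A : {fset G}) : nat :=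
  (\max_(x <- A) \max_(y <- A) dist x y)%N.

(* The suprema may be infinite, so they are taken in [\bar R]. *)
Definition helly_number (R : realType) (G : graph) : \bar R :=
  ereal_sup [set ((#|` A|)%:R)%:E | A in [set A : {fset G} | h_independent A]].

Definition helly_number2 (R : realType) (G : graph) : \bar R :=
  ereal_sup [set ((#|` A|)%:R)%:E |
    A in [set A : {fset G} | h_independent A /\ (diam A <= 2)%N]].

(* Main.v *)
(* Let A be Helly independent and a1 in A.  The sets K_a = conv(A \ a) have no
   common point, but C, the intersection of the K_a with a <> a1, contains a1.
   Call k in a convex set K an imprint of v when K meets the interval I(v,k)
   only in k, and let F(K) be the set of vertices all of whose imprints on K are
   at distance at most 2.  With convex balls, F(K) is convex and contains every
   neighbour of K, so iterating F from K_a1 yields a convex K containing K_a1,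
   disjoint from C, with some x in C and F(K).  For a <> a1 choose an imprint
   u_a of x on K lying in every K_b with b <> a, a1: among the points of K lying
   in these sets, such as a, one closest to x is an imprint.  Imprints of x at distance at most 2 from x are pairwise at distance at
   most 2, so x and the u_a form a set of diameter at most 2.  It has the size
   of A, and K and the K_a witness that it is Helly independent.

   Convexity of balls is used through two consequences: the neighbours of u on
   geodesics to v form a clique, and the triangle-pentagon condition for an edge
   whose ends are equidistant from a vertex.  Adjacency is written dist = 1. *)

Require Import Defs.
From mathcomp Require Import all_boot all_order all_algebra finmap.
From mathcomp Require Import all_classical all_reals ereal.
From mathcomp Require Import zify.

Set Implicit Arguments.
Unset Strict Implicit.
Unset Printing Implicit Defensive.

Local Open Scope classical_set_scope.

(** * Distances, geodesics and intervals *)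

Section Distance.
Variable G : graph.
Implicit Types (x y z u v : G) (K S : set G).

Lemma dist_walk x y : exists2 p, walk x y p & size p = dist x y.
Proof. by rewrite /dist; case: ex_minnP => n /asboolP. Qed.

Lemma dist_le_walk x y p : walk x y p -> dist x y <= size p.
Proof.
move=> xpy; rewrite /dist; case: ex_minnP => n _; apply.
by apply/asboolP; exists p.
Qed.

Lemma distxx x : dist x x = 0.
Proof. by apply/eqP; rewrite -leqn0; apply: (@dist_le_walk x x [::]). Qed.

Lemma dist_eq0 x y : dist x y = 0 -> x = y.
Proof. by have [p [_ <-] <-] := dist_walk x y; move/size0nil=> ->. Qed.

Lemma dist_triangle x y z : dist x z <= dist x y + dist y z.
Proof.
have [p [xp <-] <-] := dist_walk x y; have [q [yq <-] <-] := dist_walk (last x p) z.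
by rewrite -size_cat; apply: dist_le_walk; split; rewrite ?cat_path ?xp ?last_cat.
Qed.

Lemma dist_sym_le x y : dist y x <= dist x y.
Proof.
have [p [xp <-] <-] := dist_walk x y; have <- : size (rev (belast x p)) = size p.
  by rewrite size_rev size_belast.
apply: dist_le_walk; split.
  by rewrite rev_path (eq_path (e' := @adj G)) // => a b; rewrite adj_sym.
by case: p {xp} => //= a p; rewrite rev_cons last_rcons.
Qed.

Lemma distC x y : dist x y = dist y x.
Proof. by apply/eqP; rewrite eqn_leq !dist_sym_le. Qed.

Lemma shortest_path_split x y p z : shortest_path x y p -> z \in x :: p ->
  dist x z + dist z y = dist x y.
Proof.
move=> [[xp lp] sp] zp; apply/eqP; rewrite eqn_leq dist_triangle andbT -sp.
move: xp lp {sp}; case/splitPl: zp => p1 p2 lz.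
rewrite cat_path lz last_cat lz size_cat => /andP [xp1 zp2] lp.
by apply: leq_add; apply: dist_le_walk.
Qed.

Lemma shortest_path_through x y z : dist x z + dist z y = dist x y ->
  exists2 p, shortest_path x y p & z \in x :: p.
Proof.
have [p [xp pz] sp] := dist_walk x z; have [q [zq qy] sq] := dist_walk z y.
move=> e; exists (p ++ q); last first.
  by rewrite -cat_cons mem_cat -pz mem_last.
by split; [split; rewrite ?cat_path ?xp ?last_cat pz | rewrite size_cat sp sq].
Qed.

Lemma convexP S : convex S <->
  forall x y z, S x -> S y -> dist x z + dist z y = dist x y -> S z.
Proof.
split=> [cS x y z Sx Sy /shortest_path_through [p sp zp]|cS x y p Sx Sy sp z zp].
  exact: cS sp _ zp.
exact: cS Sx Sy (shortest_path_split sp zp).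
Qed.

Lemma geodesic_point x y i : i <= dist x y ->
  exists2 z, dist x z = i & dist z y = dist x y - i.
Proof.
have [p [xp <-] sp] := dist_walk x y => lei; pose z := last x (take i p).
have zi : dist x z <= i.
  rewrite -[leqRHS](@size_takel i _ p) ?sp //; apply: dist_le_walk; split=> //.
  by move: xp; rewrite -{1}(cat_take_drop i p) cat_path => /andP [].
have zy : dist z (last x p) <= dist x (last x p) - i.
  rewrite -sp -size_drop; apply: dist_le_walk; split.
    by move: xp; rewrite -{1}(cat_take_drop i p) cat_path => /andP [].
  by rewrite -{2}(cat_take_drop i p) last_cat.
have := dist_triangle x z (last x p); exists z; lia.
Qed.


(** * Consequences of convexity of balls *)

Ltac tri a b c :=
  pose proof (dist_triangle a b c); pose proof (dist_triangle b c a);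
  pose proof (dist_triangle c a b); pose proof (distC a b);
  pose proof (distC b c); pose proof (distC a c).

Hypothesis hG : has_convex_balls G.

Lemma ball_between c r u v z : dist c u <= r -> dist c v <= r ->
  dist u z + dist z v = dist u v -> dist c z <= r.
Proof. have /convexP cB := @hG c r; move=> cu cv; exact: cB. Qed.

(** If [p] and [q] were at distance 2, [u] would lie between two points of the ball of radius
    [(dist u v).-1] about [v]. *)
Lemma interval_neighbors u v p q : dist u p = 1 -> dist u q = 1 ->
  dist p v < dist u v -> dist q v < dist u v -> dist p q <= 1.
Proof.
move=> up uq pv qv; case: leqP => // pq; tri u p q.
have := @ball_between v (dist u v).-1 p q u.
rewrite !(distC v) => /(_ ltac:(lia) ltac:(lia) ltac:(lia)); lia.
Qed.

(* Among the common vertices [e] of the two intervals equidistant from the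
   edge, take a closest one. *)
Lemma triangle_pentagon x y v : dist x y = 1 -> dist x v = dist y v ->
  exists e, [/\ 0 < dist x e <= 2, dist y e = dist x e &
    dist x e + dist e v = dist x v].
Proof.
move=> xy xv; pose P j := `[< exists e, [/\ dist x e = j, dist y e = j &
  j + dist e v = dist x v] >].
have exP : exists j, P j.
  by exists (dist x v); apply/asboolP; exists v; rewrite distxx addn0.
case: (ex_minnP exP) => j /asboolP [e [xe ye ev]] min.
exists e; rewrite xe ye; split=> //; tri x y e; suff : j < 3 by lia.
case: leqP => // j3.
have [a ea ax] := @geodesic_point e x 1 ltac:(rewrite distC; lia).
have [b eb yb] := @geodesic_point e y 1 ltac:(rewrite distC; lia).
have far z : dist e z = 1 -> dist z x = j.-1 -> dist z y = j.-1 -> False.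
  move=> ez zx zy; suff /min : P j.-1 by lia.
  apply/asboolP; exists z; tri e z v; tri x z v; tri x y z; split; lia.
have ay : dist a y >= j by have := far a ea; tri a e y; tri a x y; lia.
have bx : dist b x = j by have := far b eb; tri b e x; tri b x y; lia.
(* As [j >= 3], this ball about [a] contains [b], at distance at most 2, and [x], hence also [y],
   which lies between them. *)
have := @ball_between a j.-1 x b y; tri a e b; tri x y b; lia.
Qed.

Lemma convex_between K x y z : convex K -> K x -> K y ->
  dist x z + dist z y = dist x y -> K z.
Proof. by move/convexP; apply. Qed.

Lemma dist_gt0 K x y : K x -> ~ K y -> 0 < dist x y.
Proof. by move=> Kx Ky; case: posnP => // /dist_eq0 xy; rewrite -xy in Ky. Qed.

(** * Imprints on a convex set *)

Definition imprint K v k := K k /\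
  forall z, K z -> dist v z + dist z k = dist v k -> z = k.

Lemma imprint_notin K v k : imprint K v k -> 0 < dist v k -> ~ K v.
Proof.
move=> [_ kv] vk Kv; have := kv v Kv; rewrite distxx => /(_ erefl) e.
by rewrite e distxx in vk.
Qed.

Lemma imprint_dist K v k z : imprint K v k -> K z -> 0 < dist z k ->
  dist v k < dist v z + dist z k.
Proof.
move=> [_ ik] Kz zk; tri v z k; case: leqP => // h.
by have zk' := ik z Kz; rewrite zk' ?distxx // in zk; lia.
Qed.

(* A vertex of [K] closest to [v] in the interval is an imprint. *)
Lemma ex_imprint K v k : K k ->
  exists2 z, imprint K v z & dist v z + dist z k = dist v k.
Proof.
move=> Kk; pose P j := `[< exists z, [/\ K z, dist v z = j & j + dist z k = dist v k] >].
have exP : exists j, P j.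
  by exists (dist v k); apply/asboolP; exists k; rewrite distxx addn0.
case: (ex_minnP exP) => j /asboolP [z [Kz vz zk]] min.
exists z; last by lia.
split=> // w Kw vwz; apply: dist_eq0; suff /min : P (dist v w) by lia.
by apply/asboolP; exists w; split=> //; tri v w k; tri w z k; lia.
Qed.

Definition imprints_le2 K : set G := [set v | forall k, imprint K v k -> dist v k <= 2].

Section Convex.
Variable K : set G.
Hypothesis cK : convex K.
Notation F := (imprints_le2 K).

(** Let [k] be an imprint at distance at least 3. If [p] is nearer to [k] than [v], it lies between
    [v] and [k]; if equally near, the triangle-pentagon vertex does and is in [K]; if farther, [v]
    lies between [p] and [k]. *)
Lemma nbr_imprints_le2 v p : K p -> dist v p <= 1 -> F v.
Proof.
move=> Kp vp k ik; case: leqP => // vk; have Kk := ik.1.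
have nKv := imprint_notin ik ltac:(lia).
have vp1 : dist v p = 1 by have := dist_gt0 Kp nKv; rewrite distC; lia.
have [pk|[pk|pk]] : dist p k < dist v k \/ dist p k = dist v k \/ dist v k < dist p k by lia.
- by have := imprint_dist ik Kp; tri v p k; lia.
- have [e [e2 pe ek]] := triangle_pentagon vp1 (esym pk).
  have Ke : K e by apply: convex_between cK Kp Kk _; lia.
  by have := imprint_dist ik Ke; lia.
- by case: nKv; apply: convex_between cK Kp Kk _; tri v p k; lia.
Qed.

Lemma imprints_le2_point v k : F v -> K k -> 2 <= dist v k ->
  exists z, [/\ K z, dist v z = 2 & 2 + dist z k = dist v k].
Proof.
move=> Fv Kk vk; have [w iw wk] := ex_imprint v Kk.
have vw := Fv w iw; have [z wz zk] := @geodesic_point w k (2 - dist v w) ltac:(lia).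
exists z; have Kz : K z by apply: convex_between cK iw.1 Kk _; lia.
by tri v w z; tri v z k; split=> //; lia.
Qed.

(** Otherwise the neighbour [g] of [k] towards [v], which is outside [K], falls between [k2] and [k]
    on a geodesic [k2], [k1], [k] of [K]: apply [interval_neighbors] at [k] towards [a], then at
    [k1] towards [v]. *)
Lemma imprint_nbr_farther a v k : F a -> dist v a = 1 -> imprint K v k ->
  3 <= dist v k -> dist a k <> (dist v k).+1.
Proof.
move=> Fa va ik vk ak; have Kk := ik.1.
have [z [Kz az zk]] := imprints_le2_point Fa Kk ltac:(lia).
have [m am mz] := @geodesic_point a z 1 ltac:(lia).
have vz : dist v z <= 2.
  have := @interval_neighbors a k v m; tri v a k; tri a m k; tri m z k; tri v m z; lia.
have [k2 zk2 k2k] := @geodesic_point z k (dist v k - 3) ltac:(lia).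
have Kk2 : K k2 by apply: convex_between cK Kz Kk _; lia.
have [k1 k2k1 k1k] := @geodesic_point k2 k 1 ltac:(lia).
have Kk1 : K k1 by apply: convex_between cK Kk2 Kk _; lia.
have [g kg gv] := @geodesic_point k v 1 ltac:(rewrite distC; lia).
rewrite [in dist k v]distC in gv.
have nKg : ~ K g by move=> Kg; have := imprint_dist ik Kg; tri v g k; lia.
have vk1 : dist v k1 = dist v k.
  by have := imprint_dist ik Kk1; tri v z k2; tri v k2 k1; lia.
have ak1 : dist a k1 = dist v k.
  by tri a z k2; tri a k2 k1; tri a k1 k; lia.
have gk1 : dist g k1 <= 1.
  have := @interval_neighbors k a g k1; tri k a v; tri a v g; tri k g a; tri k k1 a; lia.
have gk1' := dist_gt0 Kk1 nKg.
have gk2 : dist g k2 <= 1.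
  have := @interval_neighbors k1 v g k2; tri k1 v g; tri v z k2; tri k1 v k2; tri g k1 v; lia.
apply: nKg; apply: convex_between cK Kk2 Kk _; tri k2 g k; lia.
Qed.

(** As in [imprint_nbr_farther], but [g] is taken towards the triangle-pentagon vertex [e], so that
    it is nearer than [k] to both [a] and [v]. *)
Lemma imprint_nbr_equidistant a v k k1 k2 : dist v a = 1 -> imprint K v k ->
  3 <= dist v k -> dist a k = dist v k -> K k1 -> K k2 ->
  dist k1 k = 1 -> dist k2 k1 = 1 -> dist k2 k = 2 ->
  dist a k1 < dist v k -> dist v k2 < dist v k -> False.
Proof.
move=> va ik vk ak Kk1 Kk2 k1k k21 k2k ak1 vk2.
have [e [e2 ae ek]] := triangle_pentagon va (esym ak).
have [g kg ge] := @geodesic_point k e 1 ltac:(rewrite distC; lia).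
have nKg : ~ K g.
  by move=> Kg; have := imprint_dist ik Kg; tri v e g; tri v g k; tri k g e; lia.
have gk1 := dist_gt0 Kk1 nKg; have gk2 := dist_gt0 Kk2 nKg.
have vk1 : dist v k1 = dist v k by have := imprint_dist ik Kk1; tri v k2 k1; lia.
have g1 : dist g k1 <= 1.
  by have := @interval_neighbors k a g k1; tri k a k1; tri a e g; tri k a g; tri k g e; lia.
have g2 : dist g k2 <= 1.
  have := @interval_neighbors k1 v g k2; tri k1 v k2; tri v e g; tri k1 v g.
  by tri k g e; tri k1 g k; lia.
apply: nKg; apply: convex_between cK Kk2 ik.1 _; tri k2 g k; lia.
Qed.

Lemma imprint_le3 a v k : F a -> dist v a = 1 -> imprint K v k -> dist v k <= 3.
Proof.
move=> Fa va ik; case: leqP => // vk; have Kk := ik.1.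
have := imprint_nbr_farther Fa va ik ltac:(lia).
have [z [Kz az zk]] := imprints_le2_point Fa Kk ltac:(tri v a k; lia).
have [ak|[ak|ak]] : dist a k = (dist v k).+1 \/ dist a k = dist v k \/ dist a k < dist v k.
  by tri v a k; lia.
- by rewrite ak; case.
- move=> _.
  (* Here [dist z k] is [dist v k - 2], at least 2 since [dist v k] exceeds 3, which leaves room for
     [k2] and [k1]. *)
  have [k2 zk2 k2k] := @geodesic_point z k (dist v k - 4) ltac:(lia).
  have Kk2 : K k2 by apply: convex_between cK Kz Kk _; lia.
  have [k1 k21 k1k] := @geodesic_point k2 k 1 ltac:(lia).
  have Kk1 : K k1 by apply: convex_between cK Kk2 Kk _; lia.
  exfalso; apply: (@imprint_nbr_equidistant a v k k1 k2) => //; try lia.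
    by tri a z k2; tri a k2 k1; lia.
  by tri a z k2; tri v a k2; lia.
- by have := imprint_dist ik Kz; tri v a z; tri v a k; lia.
Qed.

(** If an imprint [k] at distance 3 has [dist a k = 3], a neighbour [z] of [k] in [K], 2 away from
    [a], replaces it: were [z] not an imprint, [K] would contain a [k2] excluded by
    [imprint_nbr_equidistant]. *)
Lemma ex_imprint3 a v : F a -> dist v a = 1 -> ~ F v ->
  exists k, [/\ imprint K v k, dist v k = 3 & dist a k = 2].
Proof.
move=> Fa va /existsNP [k] /not_implyP [ik /negP]; rewrite -ltnNge => vk3.
have vk : dist v k = 3 by have := imprint_le3 Fa va ik; lia.
have Kk := ik.1; have nak := imprint_nbr_farther Fa va ik vk3.
have [ak|ak] : dist a k = 2 \/ dist a k = 3 by tri v a k; lia.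
  by exists k.
have [z [Kz az zk]] := imprints_le2_point Fa Kk ltac:(lia).
have vz : dist v z = 3 by have := imprint_dist ik Kz; tri v a z; lia.
have [w iw wz] := ex_imprint v Kz.
have := imprint_le3 Fa va iw.
case: (leqP 3 (dist v w)) => [vw _|vw _].
  have wz0 : w = z by apply: dist_eq0; lia.
  by exists z; rewrite -wz0 in az vz *.
have [k2 wk2 k2z] := @geodesic_point w z (2 - dist v w) ltac:(lia).
have Kk2 : K k2 by apply: convex_between cK iw.1 Kz _; lia.
have vk2 : dist v k2 = 2 by tri v w k2; tri v k2 z; lia.
case: (@imprint_nbr_equidistant a v k z k2) => //; try lia.
by have := imprint_dist ik Kk2; tri k2 z k; tri v k2 k; lia.
Qed.

(** Otherwise [dist u w = 3]. No vertex outside [K], such as [x], [p] or [q], lies between [u] and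
    [w], while the triangle-pentagon vertex [e] of the edge [p u] does. *)
Lemma dist_imprints_le2 x u w : ~ K x -> imprint K x u -> imprint K x w ->
  dist x u <= 2 -> dist x w <= 2 -> dist u w <= 2.
Proof.
move=> nKx iu iw xu xw; case: leqP => // uw; have [Ku Kw] := (iu.1, iw.1).
have nbetw z : ~ K z -> dist u w < dist u z + dist z w.
  by move=> nKz; tri u z w; case: ltngtP => // [|e]; [lia|]; case: nKz;
     apply: convex_between cK Ku Kw _; lia.
have uw3 : dist u w = 3 by have := nbetw x nKx; tri u x w; lia.
have [xu2 xw2] : dist x u = 2 /\ dist x w = 2 by have := nbetw x nKx; tri u x w; lia.
have [p xp pu] := @geodesic_point x u 1 ltac:(lia).
have [q xq qw] := @geodesic_point x w 1 ltac:(lia).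
have nKp : ~ K p by move=> Kp; have := imprint_dist iu Kp; lia.
have nKq : ~ K q by move=> Kq; have := imprint_dist iw Kq; lia.
have pw : dist p w = 3 by have := nbetw p nKp; tri u p w; tri x p w; lia.
have qu : dist q u = 3 by have := nbetw q nKq; tri u q w; tri x q u; lia.
have pu1 : dist p u = 1 by lia.
have [e [e2 ue ew]] := @triangle_pentagon p u w pu1 ltac:(lia).
have Ke : K e by apply: convex_between cK Ku Kw _; lia.
have xe := dist_gt0 Ke nKx; have qe := dist_gt0 Ke nKq.
(* In the first case [e] lies between [x] and [u]; in the second [q] lies between [x] and [e], both
   within 2 of [u]. *)
have [pe|pe] : dist p e = 1 \/ dist p e = 2 by lia.
  have := @interval_neighbors p w x e; tri x p w; have := imprint_dist iu Ke.
  tri x p e; tri u e x; lia.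
have qe1 : dist q e <= 1.
  have := @interval_neighbors w p q e; tri x p q; tri p q w; tri p w e; tri q w e; lia.
have xe2 : dist x e = 2.
  by have := imprint_dist iw Ke; tri x q e; tri x e w; lia.
have := @ball_between u 2 x e q; tri u x q; tri u e q; lia.
Qed.

End Convex.

(** * Geodesics near the ends of an edge *)

(* This lemma and the next say that the union of the balls of radius 2 around
   the ends of an edge contains short intervals between its points. *)
Lemma edge_ball2_nbrs k l a b v : dist k l = 1 -> dist a l <= 2 -> dist b k <= 2 ->
  dist v a = 1 -> dist v b = 1 -> 3 <= dist v k -> 3 <= dist v l -> dist a b <= 1.
Proof.
move=> kl al bk va vb vk vl; case: leqP => // ab; exfalso; tri a v b.
have ak : dist a k = 3.
  by have := @ball_between k 2 a b v; tri k a b; tri k b v; tri k a l; lia.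
have bl : dist b l = 3.
  by have := @ball_between l 2 a b v; tri l a b; tri l a v; tri l b k; lia.
have [vk3 vl3] : dist v k = 3 /\ dist v l = 3 by tri v b k; tri v a l; lia.
have [p ap pl] := @geodesic_point a l 1 ltac:(tri a k l; lia).
have [q bq qk] := @geodesic_point b k 1 ltac:(tri b k l; lia).
have aq : dist a q = 3.
  by have := @ball_between a 2 l q k; tri a b q; tri l k q; tri b l q; tri a k l; lia.
have bp : dist b p = 3.
  by have := @ball_between b 2 k p l; tri a b p; tri l k p; tri a k p; tri b k l; lia.
(* Such a [c] would be within 1 of [p] and [q], hence, by the clique property at [q] towards [a],
   within 1 of [b], against [bl]. *)
have triangle c : dist k c = 1 -> dist l c = 1 -> dist v c = 2 -> False.
  move=> kc lc vc.
  have cq : dist c q <= 1.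
    by have := @interval_neighbors k v c q; tri v b q; tri k c v; tri k q v; tri b k l; lia.
  have cp : dist c p <= 1.
    by have := @interval_neighbors l v c p; tri v a p; tri l c v; tri l p v; tri a k l; lia.
  have := @interval_neighbors q a b c; tri q a b; tri q a c; tri c p a; tri b c l.
  tri q l b; tri q c l; tri a k l; tri b k l; lia.
have [e [e2 le ev]] := @triangle_pentagon k l v kl ltac:(tri v k l; lia).
have [ke|ke] : dist k e = 1 \/ dist k e = 2 by lia.
  by apply: (triangle e); tri v k e; lia.
have ae : dist a e <= 1.
  by have := @interval_neighbors v l a e; tri v l e; tri v e k; lia.
have be : dist b e <= 1.
  by have := @interval_neighbors v k b e; tri v k e; lia.
have [r lr re] := @geodesic_point l e 1 ltac:(lia).
have kr : dist k r <= 1.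
  by have := @interval_neighbors l b k r; tri l b k; tri b e r; tri b r l; lia.
by apply: (triangle r); tri k r e; tri v k e; tri v e r; tri v r l; lia.
Qed.

Lemma edge_ball2_geodesic k l b v y z : dist k l = 1 -> dist b k <= 2 -> dist z l <= 2 ->
  dist b v = 1 -> dist v y = 1 -> dist y z = 1 -> dist b z = 3 ->
  3 <= dist v k -> 3 <= dist v l -> 3 <= dist y k -> 3 <= dist y l -> False.
Proof.
move=> kl bk zl bv vy yz bz vk vl yk yl; tri b v z; tri b y z; tri v y z; tri b v y.
have bl : dist b l = 3.
  by have := @ball_between l 2 b z v; tri l b z; tri l v b; tri b k l; lia.
have vl3 : dist v l = 3.
  by have := @ball_between l 3 b z v; tri l b z; tri l v b; lia.
have yl3 : dist y l = 3.
  by have := @ball_between l 3 b z y; tri l b z; tri l y b; lia.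
have vside c : dist v c = 1 -> dist c l <= 2 -> dist c b <= 1.
  move=> vc cl; apply: (@edge_ball2_nbrs k l c b v) => //; lia.
have yside c : dist y c = 1 -> dist c l <= 2 -> dist c z <= 1.
  move=> yc cl; case: leqP => // cz.
  have := @ball_between l 2 c z y; tri c y z; tri l c z; tri l y z; lia.
have [e [e2 ye el]] := @triangle_pentagon v y l vy ltac:(lia).
have [ve|ve] : dist v e = 1 \/ dist v e = 2 by lia.
  by have := vside e ve; have := yside e; tri b e z; lia.
have [p vp pe] := @geodesic_point v e 1 ltac:(lia).
have [q yq qe] := @geodesic_point y e 1 ltac:(lia).
have pb : dist p b <= 1 by apply: vside => //; tri p e l; lia.
have qz : dist q z <= 1 by apply: yside => //; tri q e l; lia.
have be : dist b e = 2 by tri b p e; tri b e l; lia.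
have ke : dist k e <= 1.
  by have := @interval_neighbors l b k e; tri l b k; tri l b e; tri l k e; lia.
have qk : dist q k <= 2 by tri q e k; lia.
have vq : dist b v + dist v q <> dist b q.
  by move=> e0; have := @ball_between k 2 b q v; tri k b q; tri k b v; lia.
have bq : dist b q = 2 by tri b y q; tri v y q; tri b v q; tri b q z; lia.
(* The midpoint [m] is within 2 of [k] and adjacent to [y], so [edge_ball2_nbrs] puts it within 1 of
   [z], against [bz]. *)
have [m bm mq] := @geodesic_point b q 1 ltac:(lia).
have mk : dist m k <= 2.
  by have := @ball_between k 2 b q m; tri k b q; tri k b m; lia.
have vm : dist v m <= 1.
  by have := @interval_neighbors b z v m; tri m q z; lia.
have my : dist m y <= 1.
  by have := @ball_between m 1 v q y; tri v y q; tri b v q; tri m v q; tri m y q; lia.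
have := @edge_ball2_nbrs k l z m y kl; tri m y k; tri b m z; lia.
Qed.

(** * From local to global convexity *)

(** A walk of length [n] inside [S], cut at its end [b] to suit the induction of
    [locally_convex]. *)
Definition linked_in S := fix linked n a b : Prop :=
  if n is n'.+1 then exists s, [/\ linked n' a s, S b & dist s b = 1] else S a /\ a = b.

Lemma linked_in_dist S n a b : linked_in S n a b -> dist a b <= n.
Proof.
elim: n b => [|n IHn] b /=; first by case=> _ <-; rewrite distxx.
by case=> s [/IHn an _ sb]; tri a s b; lia.
Qed.

Lemma linked_in_geodesic S n a b c : linked_in S n a b ->
  (forall x, dist b x + dist x c = dist b c -> S x) -> linked_in S (n + dist b c) a c.
Proof.
move=> nab; move bc: (dist b c) => m; elim: m c bc => [|m IHm] c bc Sbc.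
  by rewrite addn0 -(dist_eq0 bc).
have [s cs sb] := @geodesic_point c b 1 ltac:(tri b c b; lia).
rewrite addnS /=; exists s; tri b c s; split; [|by apply: Sbc; rewrite distxx; lia|by lia].
apply: IHm => [|x xs]; first by lia.
by apply: Sbc; tri b x c; tri x s c; lia.
Qed.

(** Induction on the length of a walk in [S] from [a] to [b]: the triangle-pentagon condition
    reroutes the end of the walk, and [S3] covers the intervals near [b]. *)
Lemma locally_convex S :
  (forall a b x, S a -> S b -> dist a b <= 3 -> dist a x + dist x b = dist a b -> S x) ->
  (forall a b, S a -> S b -> exists n, linked_in S n a b) -> convex S.
Proof.
move=> S3 linkS; apply/convexP => a b x Sa Sb; have [n] := linkS a b Sa Sb.
elim/ltn_ind: n b x Sb => -[|n] IHn b x Sb.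
  by move=> [_ <-]; rewrite distxx => h; rewrite -(@dist_eq0 a x) //; lia.
move=> /= [s [nas _ sb]]; have asn := linked_in_dist nas.
have Ss : S s by case: (n) nas => [[]|m [t []]] // Sa' <-.
have Sas y : dist a y + dist y s = dist a s -> S y by apply: IHn Ss nas.
(* It is enough to find a neighbour [c] of [b] nearer to [a] such that the whole interval from [a]
   to [c] lies in [S]. *)
suff geodesic c : dist c b = 1 -> dist a c < dist a b ->
    (forall y, dist a y + dist y c = dist a c -> S y) ->
    dist a x + dist x b = dist a b -> S x.
  tri a s b.
  have [lt|[eq|lt]] : dist a s < dist a b \/ dist a s = dist a b \/ dist a b < dist a s by lia.
  - exact: (geodesic s).
  - have [e [e2 be ea]] := @triangle_pentagon s b a sb ltac:(tri s b a; tri a s b; lia).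
    have Se : S e by apply: Sas; tri a e s; tri e a s; lia.
    tri b e a; tri e s a.
    have [c bc ce] := @geodesic_point b e 1 ltac:(lia).
    have Sc : S c by apply: S3 Sb Se _ _; lia.
    tri c e a; tri b c a.
    apply: (geodesic c) => // [||y]; [lia|lia|].
    apply: (IHn (dist a e + dist e c)) => //; first by tri b c e; lia.
    apply: linked_in_geodesic => [|w wc].
      rewrite -[dist a e]add0n; apply: linked_in_geodesic => // w we.
      by apply: Sas; tri a w s; tri w e s; tri a e s; lia.
    by apply: S3 Se Sc _ wc; tri b c e; lia.
  - by move=> xb; apply: Sas; tri a x s; tri x b s; lia.
move=> cb ac Sac xb; have [xb0|xb0] := posnP (dist x b).
  by rewrite (dist_eq0 xb0).
have [c' bc' c'x] := @geodesic_point b x 1 ltac:(tri a b x; lia).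
have an : dist a b <= n.+1 by tri a s b; lia.
have ac' : dist a c' < dist a b by tri a c' x; tri x b c'; lia.
tri a c b; tri a c' b; tri b x c'; tri a x c'.
have cc' : dist c c' <= 1.
  by have := @interval_neighbors b a c c'; lia.
suff [Sc' [m [mn /(IHn m mn)]]] : S c' /\ exists m, m < n.+1 /\ linked_in S m a c'.
  by apply=> //; lia.
have [/dist_eq0 <-|c1] := posnP (dist c c').
  split; first by apply: Sac; rewrite distxx; lia.
  exists (dist a c); split; first by lia.
  by rewrite -[dist a c]add0n; apply: linked_in_geodesic.
have [e [e2 ce ea]] := @triangle_pentagon c c' a ltac:(lia) ltac:(tri c c' a; lia).
tri e c a; tri e c' a; tri e c b; tri e a b; tri e c' b.
have Se : S e by apply: Sac; lia.
(* [e] is within 2 of [c], hence within 3 of [b], the bound in [S3]. *)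
have Seb y : dist e y + dist y b = dist e b -> S y by apply: S3 => //; lia.
split; first by apply: Seb; lia.
exists (dist a e + dist e c'); split; first by lia.
apply: linked_in_geodesic => [|w wc].
  rewrite -[dist a e]add0n; apply: linked_in_geodesic => // w we.
  by apply: Sac; tri a w c; tri w e c; lia.
by apply: Seb; tri w c' b; tri e w b; lia.
Qed.

(** * Convexity of [imprints_le2 K] *)

Section Imprints.
Variable K : set G.
Hypothesis cK : convex K.
Notation F := (imprints_le2 K).

(** Let [k] be an imprint of [v] with [dist a k = 2]. The ball of radius 2 about [k] settles
    [dist b k <= 2]; otherwise [k] and its neighbour [z] in [K] towards [b] form the edge for
    [edge_ball2_nbrs]. *)
Lemma imprints_le2_nbrs a b v : F a -> F b -> dist v a = 1 -> dist v b = 1 ->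
  ~ F v -> dist a b <= 1.
Proof.
move=> Fa Fb va vb nFv; have [k [ik vk ak]] := ex_imprint3 cK Fa va nFv.
have Kk := ik.1; have nbk := imprint_nbr_farther cK Fb vb ik ltac:(lia).
have [bk|bk] : dist b k <= 2 \/ dist b k = 3 by tri v b k; lia.
  case: leqP => // ab; tri a v b.
  by have := @ball_between k 2 a b v; tri k a v; tri k b v; lia.
have [z [Kz bz zk]] := imprints_le2_point cK Fb Kk ltac:(lia).
have vz := imprint_dist ik Kz ltac:(lia).
by rewrite distC; apply: (@edge_ball2_nbrs k z b a v) => //; tri k z v; lia.
Qed.

(* With [k] the imprint of [v] at distance 2 from [b], either [k] or its
   neighbour in [K] towards [y] is at distance 3 from both [v] and [y]. *)
Lemma ex_common_imprint3 b v y z : F b -> F z -> dist b v = 1 -> dist v y = 1 ->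
  dist y z = 1 -> dist b y = 2 -> ~ F v -> ~ F y ->
  exists k, [/\ imprint K v k, dist v k = 3, dist b k = 2 & dist y k = 3].
Proof.
move=> Fb Fz bv vy yz byE nFv nFy.
have [k [ik vk bk]] := ex_imprint3 cK Fb (etrans (distC v b) bv) nFv.
have Kk := ik.1.
have yk3 : 3 <= dist y k.
  by case: ltnP => // yk; have := @ball_between k 2 b y v; tri k b v; tri k y v; lia.
have [yk|yk] : dist y k = 3 \/ dist y k = 4 by tri y v k; lia.
  by exists k.
have [w iw wk] := ex_imprint y Kk; have yw := imprint_le3 cK Fz yz iw.
have [l lk lw] := @geodesic_point k w 1 ltac:(tri k w y; lia).
have Kl : K l by apply: convex_between cK Kk iw.1 _; tri k w l; lia.
have yl : dist y l = 3 by tri y w l; tri y l k; tri k w l; lia.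
have [g bg gk] := @geodesic_point b k 1 ltac:(lia).
have nKg : ~ K g by move=> Kg; have := imprint_dist ik Kg; tri v b g; lia.
have vg : dist v g = 2 by tri v b g; tri v g k; lia.
have gl1 := dist_gt0 Kl nKg; have vl := imprint_dist ik Kl ltac:(tri l k y; lia).
have gl : dist g l <= 1.
  by have := @interval_neighbors k y g l; tri y v g; tri k g y; tri k l y; lia.
have vl3 : dist v l = 3 by tri v g l; tri k l v; lia.
exists l; split=> //; last by tri b g l; tri v b l; tri k l v; lia.
(* If [l] were not an imprint, some neighbour [h] of [l] in [K] would put [g] between [h] and [k],
   hence in [K]. *)
split=> // z' Kz' vz'; apply: dist_eq0; case: (posnP (dist z' l)) => // z'l.
have [h lh hz'] := @geodesic_point l z' 1 ltac:(rewrite distC; lia).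
have Kh : K h by apply: convex_between cK Kl Kz' _; tri l h z'; lia.
have vh : dist v h = 2 by tri v h z'; tri v h l; tri l h z'; lia.
have gh1 := dist_gt0 Kh nKg.
have gh : dist g h <= 1.
  by have := @interval_neighbors l v g h; tri l g v; tri l h v; lia.
have hk : 2 <= dist h k by have := imprint_dist ik Kh; tri v h k; lia.
by case: nKg; apply: convex_between cK Kh Kk _; tri h g k; lia.
Qed.

(** With [k] from [ex_common_imprint3], a neighbour of [k] in [K] within 2 of [z] contradicts
    [edge_ball2_geodesic]; if [dist z k = 4], one towards an imprint of [y] is too close to [y]. *)
Lemma imprints_le2_geodesic3 b v y z : F b -> F z -> dist b v = 1 -> dist v y = 1 ->
  dist y z = 1 -> dist b z = 3 -> ~ F v -> ~ F y -> False.
Proof.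
move=> Fb Fz bv vy yz bz nFv nFy; tri b v z; tri b y z; tri b v y; tri v y z.
have [k [ik vk bk yk]] := ex_common_imprint3 Fb Fz bv vy yz ltac:(lia) nFv nFy.
have Kk := ik.1.
have zk3 : 3 <= dist z k.
  by case: ltnP => // zk; have := @ball_between k 2 b z v; tri k b v; tri k z v; lia.
have yside l : K l -> dist k l = 1 -> 3 <= dist y l.
  move=> Kl kl; case: ltnP => // yl; have := imprint_dist ik Kl; rewrite distC kl => vl.
  have := @edge_ball2_nbrs k l y b v kl; tri l k v; lia.
have [zk|zk] : dist z k = 3 \/ dist z k = 4 by tri z y k; lia.
  have [l [Kl zl lk]] := imprints_le2_point cK Fz Kk ltac:(lia).
  have kl : dist k l = 1 by rewrite distC; lia.
  have := imprint_dist ik Kl; have := yside l Kl kl.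
  have := @edge_ball2_geodesic k l b v y z kl; tri l k v; lia.
have [w iw wk] := ex_imprint y Kk; have yw := imprint_le3 cK Fz yz iw.
have [/dist_eq0 wk0|wk0] := posnP (dist w k).
  by rewrite wk0 in iw; have := imprint_nbr_farther cK Fz yz iw ltac:(lia); lia.
have [l kl lw] := @geodesic_point k w 1 ltac:(rewrite distC; lia).
have Kl : K l by apply: convex_between cK Kk iw.1 _; tri k w l; lia.
by have := yside l Kl kl; tri y w l; tri k w l; lia.
Qed.

Lemma imprints_le2_interval3 a b x : F a -> F b -> dist a b <= 3 ->
  dist a x + dist x b = dist a b -> F x.
Proof.
move=> Fa Fb ab axb; apply: contrapT => nFx; tri a x b.
have [/dist_eq0 e|ax] := posnP (dist a x); first by rewrite -e in nFx.
have [/dist_eq0 e|xb] := posnP (dist x b); first by rewrite e in nFx.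
have mid c d : F c -> F d -> dist c d = 2 -> dist x c = 1 -> dist x d = 1 -> False.
  by move=> Fc Fd cd xc xd; have := imprints_le2_nbrs Fc Fd xc xd nFx; rewrite cd.
have far c d : F c -> F d -> dist c d = 3 -> dist x c = 1 -> dist x d = 2 -> False.
  move=> Fc Fd cd xc xd; have [y xy yd] := @geodesic_point x d 1 ltac:(lia).
  have [Fy|nFy] := pselect (F y).
    by apply: (mid c y) => //; tri c x y; tri c y d; lia.
  apply: (@imprints_le2_geodesic3 c x y d) => //; tri c x y; lia.
have [h|[h|h]] : dist a b = 2 \/ (dist a b = 3 /\ dist a x = 1) \/
    (dist a b = 3 /\ dist a x = 2) by lia.
- by apply: (mid a b) => //; lia.
- by apply: (far a b) => //; lia.
- by apply: (far b a) => //; tri a b x; lia.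
Qed.

(** Vertices of [F] are linked through their imprints, at distance at most 2, and a geodesic in [K];
    [k0] ensures that imprints exist. *)
Lemma convex_imprints_le2 k0 : K k0 -> convex F.
Proof.
move=> Kk0; apply: locally_convex; first exact: imprints_le2_interval3.
move=> a b Fa Fb; have [p ip _] := ex_imprint a Kk0; have [q iq _] := ex_imprint b Kk0.
have ap := Fa p ip; have bq := Fb q iq.
have KF v : K v -> F v by move=> Kv; apply: nbr_imprints_le2 Kv _ => //; rewrite distxx.
exists (0 + dist a p + dist p q + dist q b).
have [Kp Kq] := (ip.1, iq.1).
apply: linked_in_geodesic => [|x]; last first.
  by apply: imprints_le2_interval3 => //; [exact: KF|rewrite distC; lia].
apply: linked_in_geodesic => [|x xpq]; last by apply: KF; apply: convex_between cK Kp Kq xpq.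
apply: linked_in_geodesic => // x.
by apply: imprints_le2_interval3 => //; [exact: KF|lia].
Qed.

End Imprints.

(** * Convex hulls and iterated enlargement *)

Lemma convex_conv S : convex (conv S).
Proof.
apply/convexP => x y z Sx Sy xzy M [cM SM].
by apply: (convex_between cM _ _ xzy); [apply: Sx | apply: Sy]; split.
Qed.

Lemma sub_conv S : S `<=` conv S.
Proof. exact: sub_smallest. Qed.

Lemma conv_sub S M : convex M -> S `<=` M -> conv S `<=` M.
Proof. by move=> cM SM; apply: smallest_sub. Qed.

Lemma convex_bigcap (I : Type) (D : set I) (M : I -> set G) :
  (forall i, D i -> convex (M i)) -> convex (\bigcap_(i in D) M i).
Proof.
move=> cM; apply/convexP => x y z Mx My xzy i Di.
by apply: convex_between (cM i Di) (Mx i Di) (My i Di) xzy.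
Qed.

(** The iterates [Y n] are convex and contain the ball of radius [n] about [k0], so one of them
    meets [C]; [K] is the one just before the first that does. *)
Lemma ex_convex_imprints K0 C k0 c0 : convex K0 -> K0 k0 -> C c0 ->
  K0 `&` C = set0 -> exists K x,
  [/\ convex K, K0 `<=` K, K `&` C = set0, C x & imprints_le2 K x].
Proof.
move=> cK0 K0k0 Cc0 K0C; pose Y n := iter n imprints_le2 K0.
have Yk0 n : convex (Y n) /\ K0 `<=` Y n.
  elim: n => [|n [cY K0Y]]; first by split=> // x.
  split; first exact: (@convex_imprints_le2 (Y n) cY k0 (K0Y _ K0k0)).
  by move=> k /K0Y Yk; apply: nbr_imprints_le2 Yk _ => //; rewrite distxx.
have Yball n v : dist v k0 <= n -> Y n v.
  elim: n v => [|n IHn] v vn; first by rewrite (@dist_eq0 v k0) //; lia.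
  have [[cY K0Y] [v0|v0]] := (Yk0 n, posnP (dist v k0)).
    by rewrite (dist_eq0 v0); have [_] := Yk0 n.+1; apply.
  have [w vw wk] := @geodesic_point v k0 1 v0.
  by apply: (nbr_imprints_le2 cY (IHn w _)); lia.
have exP : exists n, `[< Y n `&` C !=set0 >].
  by exists (dist c0 k0); apply/asboolP; exists c0; split=> //; apply: Yball.
case: (ex_minnP exP) => -[|n] /asboolP [x [Yx Cx]] min.
  by have : (K0 `&` C) x by []; rewrite K0C.
exists (Y n), x; have [cY K0Y] := Yk0 n; split=> //.
apply: contrapT => /eqP/set0P YC; suff : n.+1 <= n by rewrite ltnn.
by apply: min; apply/asboolP.
Qed.

End Distance.

(** * The Helly independent set of diameter at most 2 *)

Lemma diam_leP (G : graph) (A : {fset G}) n :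
  reflect {in A &, forall x y, dist x y <= n} (diam A <= n).
Proof.
apply: (iffP (bigmax_leqP_seq _ _ _ _)) => [dA x y xA yA|dA x xA _].
  by have /bigmax_leqP_seq := dA x xA isT; apply.
by apply/bigmax_leqP_seq => y yA _; apply: dA.
Qed.

Lemma h_independent_diam2 (G : graph) (hG : has_convex_balls G) (A : {fset G}) :
  h_independent A ->
  exists A' : {fset G}, [/\ h_independent A', diam A' <= 2 & #|` A'| = #|` A|].
Proof.
move=> indA; case: (leqP (diam A) 2) => [dA|dA]; first by exists A.
(* A second element [a2] makes [Kf a1] nonempty. *)
have [a1 [a2 [a1A a2A a21]]] : exists a1 a2, [/\ a1 \in A, a2 \in A & a2 != a1].
  apply: contrapT => none; move: dA; apply/negP; rewrite -leqNgt.
  apply/diam_leP => x y xA yA; have [->|xy] := eqVneq x y; first by rewrite distxx.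
  by case: none; exists y, x.
pose Kf a := conv [set` (A `\ a)%fset].
have KfA a b : b \in A -> b != a -> Kf a b.
  by move=> bA ba; apply: sub_conv; rewrite /= in_fsetD1 ba.
pose B := (A `\ a1)%fset.
pose C := \bigcap_(a in [set` B]) Kf a.
have Ca1 : C a1.
  by move=> a /=; rewrite in_fsetD1 => /andP [aa1 aA]; apply: KfA; rewrite // eq_sym.
have KC : Kf a1 `&` C = set0.
  rewrite -subset0 -indA => z [za1 zC] a /= aA.
  by have [->//|aa1] := eqVneq a a1; apply: zC; rewrite /= in_fsetD1 aa1.
have [K [x [cK KfK K0 Cx Fx]]] :=
  ex_convex_imprints hG (@convex_conv _ _) (KfA a1 a2 a2A a21) Ca1 KC.
have nKC z : K z -> C z -> False by move=> Kz Cz; have : (K `&` C) z by []; rewrite K0.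
have /choice [u uP] a : exists w, a \in B ->
    [/\ imprint K x w, dist x w <= 2 & forall b, b \in B -> b != a -> Kf b w].
  (* Outside [B] the default value is [x]. *)
  have [aB|aB] := boolP (a \in B); last by exists x.
  pose D := \bigcap_(b in [set` (B `\ a)%fset]) Kf b.
  have cD : convex D by apply: convex_bigcap => b _; apply: convex_conv.
  have Dx : D x by move=> b /=; rewrite in_fsetD1 => /andP [_ bB]; apply: Cx.
  have aA : a \in A by move: aB; rewrite in_fsetD1 => /andP [].
  have Da : D a.
    by move=> b /=; rewrite in_fsetD1 => /andP [ba _]; apply: KfA; rewrite // eq_sym.
  have Ka : K a by apply: KfK; apply: KfA => //; move: aB; rewrite in_fsetD1 => /andP [].
  have cKD : convex (K `&` D).
    apply/convexP => p q r [Kp Dp] [Kq Dq] pr.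
    by split; [apply: convex_between cK Kp Kq pr | apply: convex_between cD Dp Dq pr].
  have [w [[Kw Dw] iw] _] := ex_imprint x (conj Ka Da : (K `&` D) a).
  (* The convex set [D] contains [x] and [w], hence all vertices between them, so [w] is an imprint
     on the whole of [K]. *)
  have ixw : imprint K x w.
    split=> // z Kz xz; apply: iw => //; split=> //.
    by apply: convex_between cD Dx Dw xz.
  exists w => _; split=> //; first exact: Fx.
  by move=> b bB ba; apply: Dw; rewrite /= in_fsetD1 ba.
have nKx : ~ K x by move=> Kx; apply: nKC Kx Cx.
have nKfu a : a \in B -> ~ Kf a (u a).
  move=> aB Kau; have [[Ku _] _ uK] := uP a aB; apply: (nKC _ Ku) => b bB.
  by have [->|ba] := eqVneq b a; [|apply: uK].
have u_inj : {in B &, injective u}.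
  move=> a b aB bB uab; apply/eqP; apply: contrapT => /negP ab; apply: (nKfu a aB).
  by rewrite uab; have [_ _] := uP b bB; apply.
pose U := [fset u a | a in B]%fset.
have KU : [set` U] `<=` K by move=> _ /= /imfsetP [a aB ->]; have [[]] := uP a aB.
have xU : x \notin U by apply/negP => /KU.
exists (x |` U)%fset; split.
(* Leaving out [x] keeps the hull in [K], leaving out [u a] keeps it in [Kf a], so a common point
   would lie in both [K] and [C]. *)
- rewrite /h_independent -subset0 => z zA'.
  have Kz : K z.
    have := zA' x (fset1U1 _ _); apply: conv_sub => //.
    by rewrite fsetU1K.
  apply: (nKC _ Kz) => a aB.
  have uA' : u a \in (x |` U)%fset by rewrite in_fset1U in_imfset ?orbT.
  have := zA' (u a) uA'; apply: conv_sub; first exact: convex_conv.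
  move=> y /=; rewrite in_fsetD1 in_fset1U => /andP [yu /orP [/eqP ->|]]; first exact: Cx.
  move=> /imfsetP [b /= bB yb]; have [_ _] := uP b bB; rewrite yb; apply=> //.
  by apply: contraNneq yu => ab; rewrite yb ab.
- have U2 w : w \in U -> imprint K x w /\ dist x w <= 2.
    by move=> /imfsetP [a aB ->]; have [] := uP a aB.
  apply/diam_leP => y z; rewrite !in_fset1U => /orP [/eqP ->|yU] /orP [/eqP ->|zU].
  + by rewrite distxx.
  + by have [] := U2 z zU.
  + by rewrite distC; have [] := U2 y yU.
  + have [[iy xy] [iz xz]] := (U2 y yU, U2 z zU).
    exact: (dist_imprints_le2 hG cK nKx iy iz).
- by rewrite cardfsU1 xU card_in_imfset //= [RHS](cardfsD1 a1) a1A.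
Qed.

Theorem theorem8p1 (R : realType) (G : graph) (hG : has_convex_balls G) :
  helly_number R G = helly_number2 R G.
Proof.
rewrite /helly_number /helly_number2; congr ereal_sup; apply/seteqP; split=> r.
  move=> [A indA <-]; have [A' [indA' dA' <-]] := h_independent_diam2 hG indA.
  by exists A'.
by move=> [A [indA _] <-]; exists A.
Qed.
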